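(* Let $H_m = \sum_{j=1}^{m} \frac{1}{j}$ denote the $m$-th harmonic number (with $H_0 = 0$). Then $$\sum_{k=0}^{\infty} \frac{\binom{2k}{k}^{2}}{32^{k}} \left(2 H_{2k} - H_{k}\right) = \frac{\ln(2)\, \Gamma^{2}\!\left(\frac{1}{4}\right)}{4 \pi \sqrt{\pi}}.$$
   Context: $\Gamma$ denotes Euler's gamma function. *)

(* Defs.v *)
From HB Require Import structures.
From mathcomp Require Import all_boot all_order all_algebra.
From mathcomp Require Import all_classical all_reals all_analysis.

Set Implicit Arguments.
Unset Strict Implicit.
Unset Printing Implicit Defensive.

Import Order.TTheory GRing.Theory Num.Theory.
Import numFieldNormedType.Exports.

Local Open Scope classical_set_scope.
Local Open Scope ring_scope.

Definition harmonic_number (R : realType) (m : nat) : R :=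
  \sum_(1 <= j < m.+1) j%:R^-1.

(* Euler's integral, which is Gamma(x) for 0 < x only: elsewhere the integral
   diverges and [Rintegral] returns a default value. *)
Definition Gamma (R : realType) (x : R) : R :=
  Rintegral (@lebesgue_measure R) `]0, +oo[
    (fun t : R => t `^ (x - 1) * expR (- t)).

(* Main.v *)
(* Writing a_k = 'C(2k, k) / 4^k, f_k = a_k^2 and O_k = H_(2k) - H_k / 2, Euler's
   transformation of 2F1(1/2 + e, 1/2; 1; x) gives, at first order in e,
   4 sum_k O_k f_k x^k = - ln(1 - x) sum_k f_k x^k.  This is checked on
   coefficients, so that at x = 1/2 the sum is (ln 2 / 2) sum_k f_k / 2^k.

   For the remaining sum, Gamma(1/4) = 4 int_0^oo exp(- u^4) du; squaring,
   substituting v = u t and integrating in u first gives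
   Gamma(1/4)^2 = 4 sqrt(pi) int_0^oo (1 + t^4)^(-1/2) dt.
   Since 1 + t^4 = (1 + t^2)^2 - 2 t^2, the binomial series and the Wallis-type
   integrals of t^(2k) / (1 + t^2)^(2k+1) turn the last integral into
   (pi / 2) sum_k f_k / 2^k. *)

Require Import Defs.
From HB Require Import structures.
From mathcomp Require Import all_boot all_order all_algebra.
From mathcomp Require Import all_classical all_reals all_analysis.
From mathcomp Require Import measurable_realfun ring lra zify.

Import Order.TTheory GRing.Theory Num.Theory.
Import numFieldNormedType.Exports.

Local Open Scope classical_set_scope.
Local Open Scope ring_scope.

(** * Central binomial coefficients *)

(** These are the Taylor coefficients (1/2)_k / k! of (1 - x)^(-1/2); the scaling by 4^k keeps them
    in [0, 1]. *)
Definition central (R : realType) (k : nat) : R := 'C(2 * k, k)%:R / 4 ^+ k.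

Lemma central0 (R : realType) : central R 0 = 1.
Proof. by rewrite /central muln0 bin0 expr0 divr1. Qed.

Lemma central_ge0 (R : realType) k : 0 <= central R k.
Proof. by rewrite divr_ge0// exprn_ge0. Qed.

Lemma centralS (R : realType) k :
  2 * k.+1%:R * central R k.+1 = (2 * k.+1%:R - 1) * central R k.
Proof.
(* Two diagonal absorptions, linked by the symmetry C(2k+1, k) = C(2k+1, k+1), step from C(2k, k) to
   C(2k+2, k+1). *)
have binS : (k.+1 * 'C(2 * k.+1, k.+1) = 2 * (2 * k).+1 * 'C(2 * k, k))%N.
  have h1 := mul_bin_diag (2 * k.+1) k.
  have h2 := mul_bin_diag (2 * k).+1 k.
  have h3 : ('C((2 * k).+1, k) = 'C((2 * k).+1, k.+1))%N.
    by rewrite -bin_sub; [congr ('C(_, _)); lia|lia].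
  rewrite (_ : (2 * k.+1).-1 = (2 * k).+1)%N in h1; last by lia.
  rewrite /= in h2; rewrite h3 in h1.
  nia.
have {}binS : (k.+1%:R * 'C(2 * k.+1, k.+1)%:R =
    2 * (2 * k.+1%:R - 1) * 'C(2 * k, k)%:R :> R).
  rewrite -natrM binS !natrM -!natr1 !natrM; ring.
have e4 : (4 : R) ^+ k != 0 by rewrite expf_neq0.
rewrite /central exprS -mulrA [X in 2 * X]mulrA binS; field.
exact: e4.
Qed.

Lemma central_le1 (R : realType) k : central R k <= 1.
Proof.
elim: k => [|k ih]; first by rewrite central0.
have k0 : 0 < 2 * k.+1%:R :> R by rewrite mulr_gt0.
rewrite -(ler_pM2l k0) centralS mulr1.
have := central_ge0 R k; have : (1 <= k.+1%:R :> R) by rewrite ler1n.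
nra.
Qed.

(** This is the coefficient recurrence of 2F1(1/2, 1/2; 1; x), whose coefficients are the
    squares. *)
Lemma central_sqrS (R : realType) k :
  k.+1%:R ^+ 2 * central R k.+1 ^+ 2 =
  (k.+1%:R - 2^-1) ^+ 2 * central R k ^+ 2.
Proof.
have h := centralS R k.
have {}h : k.+1%:R * central R k.+1 = (k.+1%:R - 2^-1) * central R k by lra.
by rewrite -!exprMn h.
Qed.

(* The coefficients of the square satisfy n c_n = n c_(n-1), by the recurrence
   for [central] and the symmetry k <-> n - k. *)
Lemma sum_central_conv (R : realType) n :
  \sum_(k < n.+1) central R k * central R (n - k) = 1.
Proof.
pose a := central R.
pose c n := \sum_(k < n.+1) a k * a (n - k)%N.
have sym m : \sum_(k < m.+1) k%:R * a k * a (m - k)%N = m%:R / 2 * c m.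
  suff : \sum_(k < m.+1) k%:R * a k * a (m - k)%N
    = \sum_(k < m.+1) (m%:R * (a k * a (m - k)%N) - k%:R * a k * a (m - k)%N).
    rewrite sumrB -mulr_sumr -/(c m); set s := \sum_(_ < _) _; lra.
  rewrite (reindex_inj rev_ord_inj)/=; apply: eq_bigr => -[k /=].
  rewrite ltnS => km _; rewrite !subSS subKn// natrB//; ring.
have cS m : c m.+1 = c m.
  have m0 : m.+1%:R / 2 != 0 :> R by rewrite mulf_neq0.
  apply: (mulfI m0); rewrite -sym big_ord_recl mul0r mul0r add0r.
  transitivity (\sum_(k < m.+1) (k%:R * a k * a (m - k)%N
                                 + 2^-1 * (a k * a (m - k)%N))).
    apply: eq_bigr => k _; rewrite /= /bump/= add1n subSS.
    have -> : k.+1%:R * a k.+1 = (k%:R + 2^-1) * a k.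
      by have := centralS R k; rewrite /a -[k.+1%:R]natr1; lra.
    ring.
  rewrite big_split/= sym -mulr_sumr -/(c m) -natr1; ring.
rewrite -/(c n); elim: n => [|n <-]; last exact: cS.
by rewrite /c big_ord1 /a central0 mulr1.
Qed.

(* Twice the sum of 1 / (2 j - 1) for 1 <= j <= k. *)
Definition odd_harmonic (R : realType) (k : nat) : R :=
  2 * harmonic_number R (2 * k) - harmonic_number R k.

Lemma odd_harmonicS (R : realType) k :
  odd_harmonic R k.+1 = odd_harmonic R k + 2 / (2 * k.+1%:R - 1).
Proof.
have hS m : harmonic_number R m.+1 = harmonic_number R m + m.+1%:R^-1.
  by rewrite /harmonic_number big_nat_recr.
rewrite /odd_harmonic (_ : 2 * k.+1 = (2 * k).+2)%N; last by lia.
rewrite !hS -[(2 * k).+2%:R]natr1 -[(2 * k).+1%:R]natr1 -[k.+1%:R]natr1 natrM.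
have k0 : 0 <= k%:R :> R by [].
by field; apply/and3P; split; apply: lt0r_neq0; lra.
Qed.

(* Coefficientwise form of -log(1 - x) F(x) = 2 sum_n odd_harmonic n f_n x^n with
   F(x) = sum_n f_n x^n: both sides solve the same first-order recurrence. *)
Lemma sum_central_sqr_log (R : realType) n :
  \sum_(k < n) central R k ^+ 2 / (n - k)%:R =
  2 * odd_harmonic R n * central R n ^+ 2.
Proof.
pose f k := central R k ^+ 2.
pose S n := \sum_(k < n) f k / (n - k)%:R.
have SS m : m.+1%:R ^+ 2 * S m.+1 =
    (m.+1%:R - 2^-1) ^+ 2 * S m + (2 * m.+1%:R - 1) * f m.
  (* With n = m + 1, write n^2 = (n - k)(n + k) + k^2: the first part cancels the denominator, and
     the second is ready for the recurrence of [f]. *)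
  have -> : m.+1%:R ^+ 2 * S m.+1 =
      \sum_(k < m.+1) (m.+1%:R + k%:R) * f k
      + \sum_(k < m.+1) k%:R ^+ 2 * f k / (m.+1 - k)%:R.
    rewrite -big_split/= mulr_sumr; apply: eq_bigr => -[k /= km] _.
    have mk0 : (m.+1 - k)%:R != 0 :> R by rewrite pnatr_eq0; lia.
    move: mk0; rewrite natrB 1?ltnW// -[m.+1%:R]natr1 => mk0; field.
    by rewrite mk0.
  rewrite [X in _ + X]big_ord_recl/= expr0n/= !mul0r add0r big_ord_recr/=.
  (* After the shift, the recurrence leaves (k + 1/2)^2 f_k / (m - k), and (k + 1/2)^2 = (m + 1/2)^2
     - (m - k)(m + 1 + k). The subtracted sum cancels the earlier one except for its term k = m. *)
  have -> : \sum_(i < m) (bump 0 i)%:R ^+ 2 * f (bump 0 i) / (m.+1 - bump 0 i)%:R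
      = (m.+1%:R - 2^-1) ^+ 2 * S m - \sum_(i < m) (m.+1%:R + i%:R) * f i.
    rewrite mulr_sumr -sumrB; apply: eq_bigr => -[k /= km] _.
    rewrite /bump/= add1n subSS central_sqrS -/(f k).
    have mk0 : (m - k)%:R != 0 :> R by rewrite pnatr_eq0; lia.
    move: mk0; rewrite natrB 1?ltnW// => mk0.
    rewrite -[m.+1%:R]natr1 -[k.+1%:R]natr1; field.
    by rewrite mk0.
  rewrite -natr1; ring.
rewrite -/(f n) -/(S n); elim: n => [|n ih].
  by rewrite /S big_ord0 /odd_harmonic /harmonic_number big_geq// mulr0 subrr mulr0 mul0r.
have n0 : n.+1%:R ^+ 2 != 0 :> R by rewrite expf_neq0.
apply: (mulfI n0); rewrite SS ih [RHS]mulrCA central_sqrS odd_harmonicS -/(f n).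
have n1 : 1 <= n.+1%:R :> R by rewrite ler1n.
by field; apply: lt0r_neq0; lra.
Qed.

(** * Power series *)

Lemma cvg_half_oo : n./2 @[n --> \oo] --> \oo.
Proof.
apply/cvgnyPge => A; exists (2 * A)%N => // n /=; lia.
Qed.

(** The partial sum of the product runs over the triangle i + j < n. This contains the square of
    side n / 2 and is contained in that of side n; as the terms are nonnegative, the partial sums
    are squeezed between two products that both tend to A B. *)
Lemma cauchy_product_cvg (R : realType) (u v : R ^nat) (A B : R) :
  (forall n, 0 <= u n) -> (forall n, 0 <= v n) ->
  series u @ \oo --> A -> series v @ \oo --> B ->
  series (fun n => \sum_(k < n.+1) u k * v (n - k)%N) @ \oo --> A * B.
Proof.
move=> u0 v0 uA vB; set w := fun n => _.
have serS (s : R ^nat) n : series s n.+1 = series s n + s n.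
  by rewrite !seriesEord/= big_ord_recr.
have nd (s : R ^nat) : (forall n, 0 <= s n) -> nondecreasing_seq (series s).
  by move=> s0; apply/nondecreasing_seqP => n; rewrite serS lerDl.
have w0 n : 0 <= w n by apply: sumr_ge0 => k _; exact: mulr_ge0.
have wE n : series w n = \sum_(k < n) u k * series v (n - k)%N.
  elim: n => [|n ih]; first by rewrite seriesEord/= !big_ord0.
  rewrite serS ih /w !big_ord_recr/= subnn subSn// subnn addrA -big_split/=.
  congr (_ + _); last by rewrite serS seriesEord/= big_ord0 add0r.
  by apply: eq_bigr => -[k /= kn] _; rewrite subSn 1?ltnW// serS mulrDr.
have w_le n : series w n <= series u n * series v n.
  rewrite wE [series u]seriesEord/= mulr_suml; apply: ler_sum => k _.
  by apply: ler_wpM2l => //; apply: nd => //; exact: leq_subr.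
have w_ge n : series u n./2 * series v n./2 <= series w n.
  apply: (@le_trans _ _ (series w (n./2 + n./2)%N)); last first.
    by apply: nd => //; lia.
  rewrite wE big_split_ord/= -[leLHS]addr0; apply: lerD; last first.
    by apply: sumr_ge0 => k _; rewrite mulr_ge0// seriesEord/= sumr_ge0.
  rewrite [series u]seriesEord/= mulr_suml; apply: ler_sum => -[k /= kn] _.
  by apply: ler_wpM2l => //; apply: nd => //; lia.
apply: (squeeze_cvgr (f := fun n => series u n./2 * series v n./2)
    (h := fun n => series u n * series v n)).
- by apply: nearW => n; rewrite w_ge w_le.
- by apply: cvgM; apply: cvg_comp; [exact: cvg_half_oo| |exact: cvg_half_oo|].
- exact: cvgM.
Qed.

(** By [sum_central_conv] the Cauchy square of the series is the geometric series, so the limit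
    squares to 1 / (1 - z). Being nonnegative, it is the positive root. *)
Lemma cvg_series_central (R : realType) (z : R) : 0 <= z < 1 ->
  series (fun k => central R k * z ^+ k) @ \oo --> (Num.sqrt (1 - z))^-1.
Proof.
move=> /andP[z0 z1]; set u := fun k => _.
have u0 n : 0 <= u n by rewrite mulr_ge0// ?central_ge0 ?exprn_ge0.
have nz1 : `|z| < 1 by rewrite ger0_norm.
have geo := @cvg_geometric_series R 1 z nz1.
have cu : cvgn (series u).
  apply: (series_le_cvg (v_ := geometric 1 z)) => // [n|n|].
  - by rewrite /= mul1r exprn_ge0.
  - by rewrite /= ler_wpM2r ?exprn_ge0 ?central_le1.
  - exact: (cvgP _ geo).
have uu : series (geometric 1 z) @ \oo --> limn (series u) * limn (series u).
  rewrite (_ : geometric 1 z = fun n => \sum_(k < n.+1) u k * u (n - k)%N).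
    exact: cauchy_product_cvg.
  apply/funext => n; rewrite /= -(sum_central_conv R n) mulr_suml.
  apply: eq_bigr => -[k /= kn] _.
  by rewrite /u -[in LHS](subnKC (kn : (k <= n)%N)) exprD mulrACA subnKC.
have L0 : 0 <= limn (series u).
  by apply: limr_ge => //; apply: nearW => n; rewrite seriesEord/= sumr_ge0.
have /eqP : limn (series u) ^+ 2 = (Num.sqrt (1 - z))^-1 ^+ 2.
  rewrite exprVn sqr_sqrtr ?subr_ge0 1?ltW// expr2 -[RHS]mul1r.
  exact: (cvg_unique _ uu geo).
by rewrite eqrXn2// ?invr_ge0 ?sqrtr_ge0// => /eqP <-.
Qed.

(** The remainder vanishes at 0 and has derivative y^n / (1 - y), so the mean value theorem bounds
    it by x^n / (1 - x), which tends to 0. The case x = 0 is set apart to have a nondegenerate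
    interval. *)
Lemma cvg_series_ln (R : realType) (x : R) : 0 <= x < 1 ->
  series (fun j => x ^+ j / j%:R) @ \oo --> - ln (1 - x).
Proof.
move=> /andP[]; rewrite le_eqVlt => /predU1P[<- _|x0 x1].
  rewrite subr0 ln1 oppr0 (_ : series _ = cst 0); first exact: cvg_cst.
  apply/funext => n; rewrite seriesEord/= big1// => -[[|j] /= _] _.
    by rewrite invr0 mulr0.
  by rewrite expr0n mul0r.
rewrite -cvg_shiftS/=.
(* The term j = 0 is 0 because the inverse of 0 is 0. Hence n + 1 terms differentiate to a geometric
   sum of n terms. *)
pose q n (y : R) := \sum_(j < n.+1) y ^+ j / j%:R.
have dq n (y : R) : is_derive y 1 (q n) (\sum_(j < n) y ^+ j).
  elim: n => [|n ih].
    rewrite big_ord0 (_ : q 0%N = cst 0); first exact: is_derive_cst.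
    by apply/funext => t; rewrite /q big_ord1 invr0 mulr0.
  rewrite (_ : q n.+1 = q n \+ (n.+1%:R^-1 *: (@id R ^+ n.+1))); last first.
    apply/funext => t; rewrite /q big_ord_recr/= [_ / _]mulrC; congr (_ + _ * _).
    by rewrite -[RHS]/((@id R ^+ n.+1) t) fctE.
  rewrite big_ord_recr/=; apply: is_deriveD; apply: is_derive_eq.
  by rewrite /GRing.scale/= mulr1 mulKf.
have dist n : `|- ln (1 - x) - q n x| <= x ^+ n / (1 - x).
  pose p y := - ln (1 - y) - q n y.
  have dp (y : R) : y < 1 -> is_derive y 1 p (y ^+ n / (1 - y)).
    move=> y1; rewrite -subr_gt0 in y1.
    rewrite (_ : p = - (@ln R \o (cst 1 - @id R)) - q n)//.
    have d1 : is_derive y 1 (cst 1 - @id R) (0 - 1) by exact: is_deriveB.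
    have d2 := @is_derive1_comp R (@ln R) (cst 1 - @id R) y _ _ (is_derive1_ln y1) d1.
    have d3 := is_deriveB (is_deriveN d2) (dq n y).
    apply: is_derive_eq; have y0 := lt0r_neq0 y1.
    have := subrX1 y n; set S := \sum_(_ < _) _ => eS.
    apply: (mulIf y0); rewrite mulfVK// mulrBl -mulrN mulrAC mulVf//.
    lra.
  have p0 : p 0 = 0.
    rewrite /p /q subr0 ln1 big1 ?subr0 ?oppr0// => -[[|j] /= _] _.
      by rewrite invr0 mulr0.
    by rewrite expr0n mul0r.
  have [y||] := @MVT R p (fun y => y ^+ n / (1 - y)) 0 x x0.
  - by rewrite in_itv/= => /andP[_ /lt_trans -/(_ _ x1)]; exact: dp.
  - apply: derivable_within_continuous => y; rewrite in_itv/= => /andP[_ yx].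
    exact/ex_derive/dp/(le_lt_trans yx).
  move=> c; rewrite in_itv/= p0 !subr0 -/(p x) => /andP[c0 cx] ->.
  have c1 := lt_trans cx x1.
  have c10 : 0 < 1 - c by rewrite subr_gt0.
  have x10 : 0 < 1 - x by rewrite subr_gt0.
  have q0 : 0 <= c ^+ n / (1 - c) by rewrite divr_ge0 ?exprn_ge0 ?ltW.
  rewrite ger0_norm; last by rewrite mulr_ge0// ltW.
  rewrite -[leRHS]mulr1; apply: ler_pM => //; [exact: ltW| |exact: ltW].
  apply: ler_pM.
  - by rewrite exprn_ge0// ltW.
  - by rewrite invr_ge0 ltW.
  - by rewrite lerXn2r ?nnegrE ?ltW.
  - by rewrite lef_pV2 ?posrE// lerD2l lerN2 ltW.
apply/cvgrPdist_le => e e0; have x10 : 0 < 1 - x by rewrite subr_gt0.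
have ex0 : 0 < e * (1 - x) by rewrite mulr_gt0.
have nx1 : `|x| < 1 by rewrite gtr0_norm.
near=> n; rewrite seriesEord/= -/(q n x); apply: (le_trans (dist n)).
rewrite ler_pdivrMr//; near: n.
have := @cvg_geometric R 1 x nx1; move=> /cvgr0_norm_le -/(_ _ ex0).
apply: filterS => n /=; rewrite mul1r ger0_norm// exprn_ge0// ltW//.
Unshelve. all: by end_near. Qed.

(** The Cauchy product with the logarithmic series at 1/2 sums to A ln 2; by [sum_central_sqr_log]
    its terms are twice those wanted, whence the factor 1/2. *)
Lemma cvg_series_odd_harmonic (R : realType) (A : R) :
  series (fun k => central R k ^+ 2 / 2 ^+ k) @ \oo --> A ->
  series (fun k => central R k ^+ 2 / 2 ^+ k * odd_harmonic R k) @ \oo -->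
  ln 2 / 2 * A.
Proof.
move=> cA.
have half01 : 0 <= (2^-1 : R) < 1 by apply/andP; split; lra.
have cln := @cvg_series_ln R 2^-1 half01.
rewrite (_ : - ln (1 - 2^-1) = ln 2 :> R) in cln; last first.
  rewrite (_ : 1 - 2^-1 = 2^-1); last by lra.
  by rewrite lnV ?opprK// posrE.
have u0 k : 0 <= central R k ^+ 2 / 2 ^+ k by rewrite divr_ge0 ?sqr_ge0 ?exprn_ge0.
have v0 j : 0 <= 2^-1 ^+ j / j%:R :> R by rewrite divr_ge0// exprn_ge0// invr_ge0.
have := cauchy_product_cvg _ _ _ _ _ u0 v0 cA cln.
rewrite (_ : ln 2 / 2 * A = 2^-1 * (A * ln 2)); last first.
  by rewrite mulrAC mulrC [ln 2 * A]mulrC.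
move=> /(@cvgMl_tmp _ _ _ _ _ 2^-1); apply: cvg_trans.
apply: near_eq_cvg; apply: nearW => n; rewrite !seriesEord/= mulr_sumr.
apply: eq_bigr => -[i /= _] _.
(* The last term of the convolution has denominator 0 and so is 0; what remains is the range k < i
   of [sum_central_sqr_log]. *)
rewrite big_ord_recr/= subnn invr0 !mulr0 addr0.
have -> : \sum_(k < i) central R k ^+ 2 / 2 ^+ k * (2^-1 ^+ (i - k) / (i - k)%:R)
    = 2^-1 ^+ i * \sum_(k < i) central R k ^+ 2 / (i - k)%:R.
  rewrite mulr_sumr; apply: eq_bigr => -[k /= ki] _.
  have -> : 2^-1 ^+ i = 2^-1 ^+ k * 2^-1 ^+ (i - k) :> R.
    by rewrite -exprD subnKC// ltnW.
  rewrite -exprVn.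
  move: (central R k ^+ 2) (2^-1 ^+ k) (2^-1 ^+ (i - k)) ((i - k)%:R^-1).
  by move=> *; ring.
rewrite sum_central_sqr_log exprVn.
set x := central R i ^+ 2; set y := odd_harmonic R i; set z := (2 ^+ i)^-1.
by rewrite [x * z]mulrC; field.
Qed.

(** * Integrals over the positive half-line *)

(** The compact intervals increase to the open half-line, so this is monotone convergence. Positive
    left ends keep a possible singularity at 0 outside. *)
Lemma cvg_integral_expand_itv0y (R : realType) (f : R -> R) (a b : nat -> R) :
  nonincreasing_seq a -> nondecreasing_seq b ->
  (forall n, 0 < a n) -> a @ \oo --> 0 -> b @ \oo --> +oo ->
  measurable_fun (`]0, +oo[ : set R) f -> (forall x, 0 < x -> 0 <= f x) ->
  (\int[@lebesgue_measure R]_(x in `[a n, b n]) (f x)%:E @[n --> \oo] -->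
   \int[@lebesgue_measure R]_(x in `]0%R, +oo[) (f x)%:E)%E.
Proof.
move=> da ib a0 ca cb mf f0.
have abE : `]0, +oo[%classic = \bigcup_n `[a n, b n]%classic :> set R.
  apply/seteqP; split => x /=.
    rewrite in_itv/= andbT => x0.
    have : \forall n \near \oo, (a n <= x) && (x <= b n).
      near=> n; apply/andP; split; near: n; first exact: (cvgr_le _ ca).
      by move/cvgryPge : cb; exact.
    by move=> [n _ /(_ n (leqnn n))] /= h; exists n => //=; rewrite in_itv.
  by move=> [n _] /=; rewrite !in_itv/= andbT => /andP[+ _]; exact: lt_le_trans.
rewrite abE; apply: ge0_nondecreasing_set_cvg_integral => //.
- move=> m n mn; rewrite subsetEset => x/=; rewrite !in_itv/= => /andP[ax xb].
  by rewrite (le_trans (da _ _ mn) ax) (le_trans xb)// ib.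
- move=> n; apply/measurable_EFinP; apply: measurable_funS mf => //.
  by rewrite abE => x abx; exists n.
- move=> n x /=; rewrite in_itv/= => /andP[ax _]; rewrite lee_fin f0//.
  exact: lt_le_trans ax.
Unshelve. all: by end_near. Qed.

(** The substitution y = c x^(p+1) is made on compact intervals, then both sides pass to the limit.
    Continuity is asked at positive points only, which admits t^(-3/4). The cases p = 0, 1, 3 serve
    for scaling, the Gaussian and Gamma(1/4). *)
Lemma ge0_integral_monomial_subst (R : realType) (c : R) (p : nat) (G : R -> R) :
  0 < c -> (forall x : R, 0 < x -> {for x, continuous G}) ->
  (forall x, 0 < x -> 0 <= G x) ->
  (\int[@lebesgue_measure R]_(x in `]0%R, +oo[) (G x)%:E =
   \int[@lebesgue_measure R]_(x in `]0%R, +oo[)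
     (G (c * x ^+ p.+1) * (c * p.+1%:R * x ^+ p))%:E)%E.
Proof.
move=> c0 cG G0.
pose F (x : R) := c * x ^+ p.+1; pose dF (x : R) := c * p.+1%:R * x ^+ p.
have dFx (x : R) : is_derive x 1 F (dF x).
  rewrite (_ : F = c *: (@id R ^+ p.+1)); last first.
    by apply/funext => t; rewrite -[RHS]/(c * (@id R ^+ p.+1) t) fctE.
  by apply: is_derive_eq; rewrite /GRing.scale/= mulr1 mulrA.
have F'E : derive1 F = dF by apply/funext => x; rewrite derive1E; exact: derive_val.
have cdF : continuous dF.
  by move=> x; apply: cvgMl_tmp; exact: exprn_continuous.
have cF : continuous F.
  by move=> x; apply: cvgMl_tmp; exact: exprn_continuous.
have F0 x : 0 < x -> 0 < F x by move=> x0; rewrite mulr_gt0// exprn_gt0.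
have ndF x y : 0 <= x -> x < y -> F x < F y.
  by move=> x0 xy; rewrite ltr_pM2l// ltrXn2r// ltW// (le_lt_trans x0).
have leF x y : 0 <= x -> x <= y -> F x <= F y.
  move=> x0; rewrite le_eqVlt => /predU1P[->//|xy]; exact/ltW/ndF.
pose a n : R := n.+1%:R^-1; pose b n : R := n.+1%:R.
have a0 n : 0 < a n by rewrite invr_gt0.
have ab n : a n <= b n.
  by rewrite /a /b (@le_trans _ _ 1)// ?ler1n// invf_le1// ler1n.
have da : nonincreasing_seq a.
  by move=> m n mn; rewrite lef_pV2 ?posrE// ler_nat.
have ib : nondecreasing_seq b by move=> m n mn; rewrite ler_nat.
have ca : a @ \oo --> 0 by exact: cvg_harmonic.
have cb : b @ \oo --> +oo.
  apply/cvgryPge => M; near=> n; rewrite /b -natr1 ler_wpDr//.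
  by near: n; exact: nbhs_infty_ger.
have mG : measurable_fun (`]0, +oo[ : set R) G.
  apply: open_continuous_measurable_fun => // x.
  by rewrite inE/= in_itv/= andbT; exact: cG.
have lhs : (\int[@lebesgue_measure R]_(x in `[F (a n), F (b n)]) (G x)%:E
    @[n --> \oo] --> \int[@lebesgue_measure R]_(x in `]0%R, +oo[) (G x)%:E)%E.
  apply: cvg_integral_expand_itv0y => //.
  - by move=> m n mn; apply: leF; [exact: ltW|exact: da].
  - by move=> m n mn; apply: leF; [exact: (le_trans (ltW (a0 m)))|exact: ib].
  - by move=> n; exact: F0.
  - have F00 : F 0 = 0 by rewrite /F expr0n mulr0.
    by have := cF 0; rewrite /continuous_at F00; exact: cvg_comp.
  - apply/cvgryPge => M; near=> n.
    have : M / c <= b n by near: n; move/cvgryPge : cb; exact.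
    rewrite ler_pdivrMr// mulrC => /le_trans; apply.
    by rewrite ler_pM2l// exprS ler_peMr// exprn_ege1// ler1n.
have rhs : (\int[@lebesgue_measure R]_(x in `[a n, b n]) (G (F x) * dF x)%:E
    @[n --> \oo] --> \int[@lebesgue_measure R]_(x in `]0%R, +oo[) (G (F x) * dF x)%:E)%E.
  apply: cvg_integral_expand_itv0y => //.
  - apply: open_continuous_measurable_fun => // x.
    rewrite inE/= in_itv/= andbT => x0.
    apply: continuousM; last exact: cdF.
    by apply: (@continuous_comp _ _ _ F G); [exact: cF|exact/cG/F0].
  - move=> x x0; rewrite mulr_ge0 ?G0 ?F0// mulr_ge0 ?exprn_ge0 ?ltW//.
    by rewrite mulr_gt0.
suff subst : (fun n => \int[@lebesgue_measure R]_(x in `[F (a n), F (b n)]) (G x)%:E)%E =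
    (fun n => \int[@lebesgue_measure R]_(x in `[a n, b n]) (G (F x) * dF x)%:E)%E.
  by rewrite subst in lhs; exact: (cvg_unique _ lhs rhs).
apply/funext => n.
rewrite integration_by_substitution_increasing//.
- by apply: eq_integral => x _; rewrite F'E.
- by move=> x y; rewrite !in_itv/= => /andP[ax _] _; exact/ndF/(le_trans (ltW (a0 n))).
- by move=> x _; rewrite F'E; exact: cdF.
- by rewrite F'E; apply: (cvgP (dF (a n))); apply: cvg_at_right_filter; exact: cdF.
- by rewrite F'E; apply: (cvgP (dF (b n))); apply: cvg_at_left_filter; exact: cdF.
- split; first by move=> x _; exact: ex_derive.
    by apply: cvg_at_right_filter; exact: cF.
  by apply: cvg_at_left_filter; exact: cF.
- apply: continuous_in_subspaceT => x; rewrite inE/= in_itv/= => /andP[ax _].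
  apply: cG; exact: (lt_le_trans (F0 _ (a0 n))).
Unshelve. all: by end_near. Qed.

(** Tonelli's theorem for the extension of [f] by 0 off D x D. Nonnegativity is thus asked on D
    only, as suits an integrand with a factor u that changes sign at 0. *)
Lemma ge0_fubini_tonelli_set (R : realType) (D : set R) (f : R * R -> \bar R) :
  measurable D -> measurable_fun setT f ->
  (forall x y, D x -> D y -> (0 <= f (x, y))%E) ->
  (\int[@lebesgue_measure R]_(x in D) \int[@lebesgue_measure R]_(y in D) f (x, y) =
   \int[@lebesgue_measure R]_(y in D) \int[@lebesgue_measure R]_(x in D) f (x, y))%E.
Proof.
move=> mD mf f0.
pose g := f \_ (D `*` D).
have mg : measurable_fun setT g.
  apply/(measurable_restrictT f) => //; first exact: measurableX.
  exact: measurable_funS mf.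
have g0 z : (0 <= g z)%E.
  case: z => x y; rewrite /g patchE; case: ifPn => //.
  by rewrite inE => -[/= Dx Dy]; exact: f0.
have := @fubini_tonelli _ _ _ _ R (@lebesgue_measure R) (@lebesgue_measure R) g mg g0.
have gE x y : g (x, y) = if x \in D then if y \in D then f (x, y) else 0%E else 0%E.
  by rewrite /g patchE in_setX; case: (x \in D); case: (y \in D).
move=> h; rewrite integral_mkcond [RHS]integral_mkcond; move: h.
have -> : (fun x => \int[@lebesgue_measure R]_y g (x, y))%E =
    (fun x => \int[@lebesgue_measure R]_(y in D) f (x, y))%E \_ D.
  apply/funext => x; rewrite patchE; case: ifPn => xD.
    rewrite [RHS]integral_mkcond; apply: eq_integral => y _.
    by rewrite gE xD patchE.
  by apply: integral0_eq => y _; rewrite gE (negbTE xD).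
have -> // : (fun y => \int[@lebesgue_measure R]_x g (x, y))%E =
    (fun y => \int[@lebesgue_measure R]_(x in D) f (x, y))%E \_ D.
apply/funext => y; rewrite patchE; case: ifPn => yD.
  rewrite [RHS]integral_mkcond; apply: eq_integral => x _.
  by rewrite gE yD patchE.
by apply: integral0_eq => x _; rewrite gE (negbTE yD); case: ifP.
Qed.

(** * Gamma(1/4) and the square of the quartic exponential integral *)

Lemma continuous_expNM4 (R : realType) (c : R) :
  continuous (fun x : R => expR (- (c * x ^+ 4))).
Proof.
move=> x; apply: (@continuous_comp _ _ _ (fun x : R => - (c * x ^+ 4)) expR).
  by apply: cvgN; apply: cvgMl_tmp; exact: exprn_continuous.
exact: continuous_expR.
Qed.

Lemma continuous_expN4 (R : realType) : continuous (fun x : R => expR (- x ^+ 4)).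
Proof.
rewrite (_ : (fun _ => _) = (fun x : R => expR (- (1 * x ^+ 4)))).
  exact: continuous_expNM4.
by apply/funext => x; rewrite mul1r.
Qed.

Lemma continuous_measurable_EFin (R : realType) (D : set R) (f : R -> R) :
  measurable D -> continuous f -> measurable_fun D (fun x => (f x)%:E).
Proof.
move=> mD cf; apply/measurable_EFinP; apply: measurable_funTS.
exact: continuous_measurable_fun.
Qed.

Lemma integral_expN4_scale (R : realType) (u : R) : 0 < u ->
  (\int[@lebesgue_measure R]_(v in `]0%R, +oo[) (expR (- v ^+ 4))%:E =
   \int[@lebesgue_measure R]_(t in `]0%R, +oo[) (expR (- (u * t) ^+ 4) * u)%:E)%E.
Proof.
move=> u0.
rewrite (@ge0_integral_monomial_subst R u 0 (fun v => expR (- v ^+ 4)))//.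
- by apply: eq_integral => t _; rewrite expr0 expr1 !mulr1.
- by move=> x _; exact: continuous_expN4.
Qed.

(** Substitute t = u^4: the Jacobian 4 u^3 cancels t^(-3/4) = u^(-3). *)
Lemma integral_Gamma14 (R : realType) :
  (\int[@lebesgue_measure R]_(t in `]0%R, +oo[) (t `^ (4^-1 - 1) * expR (- t))%:E =
   4%:E * \int[@lebesgue_measure R]_(u in `]0%R, +oo[) (expR (- u ^+ 4))%:E)%E.
Proof.
rewrite (@ge0_integral_monomial_subst R 1 3 (fun t => t `^ (4^-1 - 1) * expR (- t)))//.
- rewrite -ge0_integralZl//; last first.
    by apply: continuous_measurable_EFin => //; exact: continuous_expN4.
  apply: eq_integral => x; rewrite inE/= in_itv/= andbT => x0.
  rewrite -EFinM !mul1r; congr EFin.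
  have -> : (x ^+ 4) `^ (4^-1 - 1) = x ^- 3.
    rewrite -[x ^+ 4]powR_mulrn 1?ltW// -powRrM -powR_invn 1?ltW//.
    by congr (_ `^ _); lra.
  by move: (expR _) => e; field; rewrite gt_eqF.
- move=> x x0; apply: continuousM.
    have : derivable (@powR R ^~ (4^-1 - 1)) x 1.
      by apply: derivable_powR; rewrite in_itv/= andbT.
    by move=> /derivable1_diffP/differentiable_continuous.
  apply: (@continuous_comp _ _ _ -%R expR); first exact: continuousN.
  exact: continuous_expR.
- by move=> x x0; rewrite mulr_ge0 ?powR_ge0 ?expR_ge0.
Qed.

(** Substituting x = sqrt(c) u^2 in the Gaussian integral produces this integrand with the factor 2
    sqrt(c). *)
Lemma integral_id_expN4 (R : realType) (c : R) : 0 < c ->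
  (\int[@lebesgue_measure R]_(u in `]0%R, +oo[) (u * expR (- (c * u ^+ 4)))%:E =
   (Num.sqrt pi / (4 * Num.sqrt c))%:E)%E.
Proof.
move=> c0; have s0 : 0 < Num.sqrt c by rewrite sqrtr_gt0.
have gauss : (\int[@lebesgue_measure R]_(u in `]0%R, +oo[) (gauss_fun u)%:E =
    (Num.sqrt pi / 2)%:E)%E.
  rewrite integral_itv_obnd_cbnd ?integral0y_gauss//.
  by apply/measurable_EFinP/measurable_funTS; exact: measurable_gauss_fun.
rewrite (@ge0_integral_monomial_subst R (Num.sqrt c) 1 gauss_fun)// in gauss;
  last 2 first.
  by move=> x _; exact: continuous_gauss_fun.
  by move=> x _; exact: gauss_fun_ge0.
have : ((2 * Num.sqrt c)%:E * \int[@lebesgue_measure R]_(u in `]0%R, +oo[)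
    (u * expR (- (c * u ^+ 4)))%:E =
    (Num.sqrt pi / 2)%:E)%E.
  rewrite -gauss -ge0_integralZl//.
  - apply: eq_integral => u _; rewrite -EFinM /gauss_fun exprMn sqr_sqrtr 1?ltW//.
    by rewrite expr1 -exprM; congr EFin; ring.
  - apply: continuous_measurable_EFin => // x.
    by apply: cvgM; [exact: cvg_id|exact: continuous_expNM4].
  - move=> u; rewrite /= in_itv/= andbT => u0.
    by rewrite lee_fin mulr_ge0 ?expR_ge0 ?ltW.
(* Finiteness comes from the equation itself: an infinite value times a positive constant could not
   be finite. *)
case: (\int[_]_(_ in _) _)%E => [r| |].
- rewrite -EFinM => -[e]; congr EFin.
  apply: (@mulfI _ (2 * Num.sqrt c)); first by rewrite gt_eqF// mulr_gt0.
  by rewrite e; field; rewrite gt_eqF.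
- by rewrite gt0_muley// lte_fin mulr_gt0.
- by rewrite gt0_muleNy// lte_fin mulr_gt0.
Qed.

(** Rescaling the inner copy by v = u t merges the exponents into (1 + t^4) u^4 and leaves a factor
    u, so after Tonelli the integral in u is [integral_id_expN4] with c = 1 + t^4. The identity is
    in the extended reals, as [I] is not yet known to be finite. *)
Lemma integral_expN4_sqr (R : realType) :
  let I := (\int[@lebesgue_measure R]_(u in `]0%R, +oo[) (expR (- u ^+ 4))%:E)%E in
  (I * I = (Num.sqrt pi / 4)%:E *
    \int[@lebesgue_measure R]_(t in `]0%R, +oo[) ((Num.sqrt (1 + t ^+ 4))^-1)%:E)%E.
Proof.
move=> I.
pose h (z : R * R) := (z.1 * expR (- ((1 + z.2 ^+ 4) * z.1 ^+ 4)))%:E.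
have mexp : measurable_fun (`]0, +oo[ : set R) (fun x : R => (expR (- x ^+ 4))%:E).
  by apply: continuous_measurable_EFin => //; exact: continuous_expN4.
have I0 : (0 <= I)%E by apply: integral_ge0 => x _; rewrite lee_fin expR_ge0.
have -> : (I * I = \int[@lebesgue_measure R]_(u in `]0%R, +oo[)
    \int[@lebesgue_measure R]_(t in `]0%R, +oo[) h (u, t))%E.
  rewrite {2}/I -ge0_integralZl//.
  apply: eq_integral => u; rewrite inE/= in_itv/= andbT => u0.
  rewrite /I (integral_expN4_scale _ _ u0) muleC -ge0_integralZl//.
  - apply: eq_integral => t _; rewrite /h/= -EFinM; congr EFin.
    by rewrite mulrA -expRD mulrC exprMn; congr (_ * expR _); ring.
  - apply: continuous_measurable_EFin => // t; apply: cvgMr_tmp.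
    rewrite (_ : (fun t => _) = (fun t => expR (- (u ^+ 4 * t ^+ 4)))); last first.
      by apply/funext => x; rewrite exprMn.
    by rewrite exprMn; exact: continuous_expNM4.
  - by move=> t _; rewrite lee_fin mulr_ge0 ?expR_ge0 ?ltW.
rewrite ge0_fubini_tonelli_set//; last 2 first.
- apply/measurable_EFinP; apply: measurable_funM; first exact: measurable_fst.
  apply: measurableT_comp => //; apply: measurableT_comp => //.
  apply: measurable_funM.
    apply: measurable_funD; first exact: measurable_cst.
    by apply: measurable_funX; exact: measurable_snd.
  by apply: measurable_funX; exact: measurable_fst.
- move=> x y; rewrite /= !in_itv/= !andbT => x0 _.
  by rewrite lee_fin mulr_ge0 ?expR_ge0 ?ltW.
have t41 (t : R) : 0 < 1 + t ^+ 4 by rewrite ltr_pwDl// exprn_even_ge0.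
rewrite -ge0_integralZl//.
- apply: eq_integral => t _; rewrite /h/= integral_id_expN4// -EFinM.
  by congr EFin; rewrite invfM mulrA.
- apply: continuous_measurable_EFin => // t; apply: cvgV.
    by rewrite gt_eqF// sqrtr_gt0.
  apply: (@continuous_comp _ _ _ (fun t : R => 1 + t ^+ 4) Num.sqrt).
    by apply: cvgD; [exact: cvg_cst|exact: exprn_continuous].
  exact: sqrt_continuous.
Qed.

(** * Wallis-type integrals *)

(* With t = tan s the integrand is (sin (2 s) / 2)^(2k) ds, so the primitives
   come from the reduction formula for even powers of the sine. *)
Lemma wallis_primitive (R : realType) (k : nat) :
  exists F : R -> R, [/\ F 0 = 0,
    forall t : R, is_derive t 1 F ((t / (1 + t ^+ 2)) ^+ (2 * k) / (1 + t ^+ 2)) &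
    F t @[t --> +oo] --> pi / 2 * central R k / 4 ^+ k].
Proof.
have q0 (t : R) : 0 < 1 + t ^+ 2 by rewrite ltr_pwDl// sqr_ge0.
pose q (t : R) : R := 1 + t ^+ 2.
(* For t = tan s these are w = sin(2 s) / 2 and v = cos(2 s), with ds = dt / q. Hence w' = v / q, v'
   = - 4 w / q and v^2 = 1 - 4 w^2. *)
pose w (t : R) : R := t / q t.
pose v (t : R) : R := (1 - t ^+ 2) / q t.
have dE (f : R -> R) (t a b : R) : is_derive t 1 f a -> a = b -> is_derive t 1 f b.
  by move=> ? <-.
have did (t : R) : is_derive t 1 (@id R) 1 by exact: is_derive_id.
have dX2 (t : R) : is_derive t 1 (@id R ^+ 2) (2 * t).
  by apply: is_derive_eq; rewrite /GRing.scale/= mulr1 expr1.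
have X2E : @id R ^+ 2 = fun t => t ^+ 2 by apply/funext => t; rewrite fctE.
have dq (t : R) : is_derive t 1 q (2 * t).
  rewrite (_ : q = cst 1 + @id R ^+ 2); last by rewrite X2E.
  by apply: is_derive_eq; rewrite add0r.
have dqV (t : R) := is_deriveV (lt0r_neq0 (q0 t) : q t != 0) (dq t).
have dw (t : R) : is_derive t 1 w (v t / q t).
  apply: (dE _ _ _ _ (is_deriveM (did t) (dqV t))).
  rewrite /GRing.scale/= /v /q; field; exact: lt0r_neq0.
have dv (t : R) : is_derive t 1 v (- 4 * w t / q t).
  have d1 : is_derive t 1 (fun t : R => 1 - t ^+ 2) (- (2 * t)).
    rewrite (_ : (fun t => _) = cst 1 - @id R ^+ 2); last by rewrite X2E.
    by apply: is_derive_eq; rewrite add0r.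
  apply: (dE _ _ _ _ (is_deriveM d1 (dqV t))).
  rewrite /GRing.scale/= /w /q; field; exact: lt0r_neq0.
have v2 t : v t ^+ 2 = 1 - 4 * w t ^+ 2.
  rewrite /v /w /q; field; exact: lt0r_neq0.
have w0 : w t @[t --> +oo] --> 0.
  apply: (squeeze_cvgr (f := cst 0) (h := fun t => t^-1)).
  - near=> t; have t0 : 0 < t by [].
    apply/andP; split; first by rewrite divr_ge0// ltW// q0.
    rewrite ler_pdivrMr ?q0// /q mulrDr mulr1 expr2 mulKf ?gt_eqF//.
    by rewrite lerDr invr_ge0 ltW.
  - exact: cvg_cst.
  - by apply/(@gtr0_cvgV0 _ _ _ _ id); [near=> t|exact: cvg_id].
have wXE n t : (w ^+ n) t = w t ^+ n by rewrite fctE.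
(* Reduction formula: with m = k' + 1, the derivative of (2m - 1) F - w^(2m-1) v is 8m w^(2m) / q,
   once v^2 is replaced by 1 - 4 w^2. *)
have dF0 (k' : nat) (F : R -> R) :
   (forall t : R, is_derive t 1 F (w t ^+ (2 * k') / q t)) ->
   forall t : R, is_derive t 1
   ((8 * k'.+1%:R)^-1 *: ((2 * k'.+1%:R - 1) *: F - w ^+ (2 * k').+1 * v))
   (w t ^+ (2 * k'.+1) / q t).
  move=> dF t.
  have dR := is_deriveM (is_deriveX (2 * k').+1 (dw t)) (dv t).
  apply: (dE _ _ _ _ (is_deriveZ (8 * k'.+1%:R)^-1
    (is_deriveB (is_deriveZ (2 * k'.+1%:R - 1) (dF t)) dR))).
  rewrite /GRing.scale/= wXE (_ : (2 * k').+1%:R = 2 * k'.+1%:R - 1); last first.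
    by rewrite -[k'.+1%:R]natr1 -[(2 * k').+1%:R]natr1 natrM; ring.
  rewrite (_ : 2 * k'.+1 = (2 * k').+2)%N; last by lia.
  rewrite !exprS.
  have := v2 t; have : k'.+1%:R != 0 :> R by [].
  move: (w t) (v t) (q t)^-1 (w t ^+ (2 * k')) (k'.+1%:R : R) => x y z X m m0 y2.
  have -> : y * ((2 * m - 1) * X * (y * z)) = (2 * m - 1) * X * z * y ^+ 2 by ring.
  by rewrite y2; field.
(* The boundary term dies at infinity since |v| <= 1 and w tends to 0. *)
have R0 n : w t ^+ n.+1 * v t @[t --> +oo] --> 0.
  have wn : w t ^+ n.+1 @[t --> +oo] --> 0.
    have := @exprn_continuous R n.+1 0; rewrite /continuous_at expr0n/=.
    exact: cvg_comp.
  apply: (squeeze_cvgr (f := fun t => - w t ^+ n.+1) (h := fun t => w t ^+ n.+1)) => //.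
    near=> t; have t0 : 0 < t by [].
    have W0 : 0 <= w t ^+ n.+1 by rewrite exprn_ge0// divr_ge0// ltW// q0.
    have : `|v t| <= 1.
      rewrite -(@ler_pXn2r _ 2)// ?nnegrE// expr1n real_normK ?num_real//.
      by rewrite v2 gerBl mulr_ge0// sqr_ge0.
    by rewrite ler_norml => /andP[h1 h2]; apply/andP; split; nra.
  by rewrite -oppr0; exact: cvgN.
elim: k => [|k [F [F0 dF Foo]]].
  exists (@atan R); split; first exact: atan0.
    by move=> t; rewrite muln0 expr0 mul1r; exact: is_derive1_atan.
  by rewrite central0 mulr1 expr0 divr1; exact: cvgy_atan.
exists ((8 * k.+1%:R)^-1 *: ((2 * k.+1%:R - 1) *: F - w ^+ (2 * k).+1 * v)); split.
- rewrite -[LHS]/(_ * (_ * F 0 - (w ^+ (2 * k).+1) 0 * v 0)) wXE F0.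
  by rewrite /w mul0r expr0n/= mul0r subr0 !mulr0.
- exact: dF0.
(* The reduction factor (2m - 1) / (8m), with m = k + 1, is a quarter of the ratio of consecutive
   [central] values. *)
- have -> : pi / 2 * central R k.+1 / 4 ^+ k.+1 = (8 * k.+1%:R)^-1 *
      ((2 * k.+1%:R - 1) * (pi / 2 * central R k / 4 ^+ k) - 0).
    have k0 : k.+1%:R != 0 :> R by [].
    have -> : central R k.+1 = (2 * k.+1%:R - 1) * central R k / (2 * k.+1%:R).
      by rewrite -centralS mulrAC mulfV ?mul1r// mulf_neq0.
    have e4 : (4 : R) ^+ k != 0 by rewrite expf_neq0.
    move: k0 e4; rewrite exprS.
    move: (k.+1%:R : R) (4 ^+ k : R) (central R k) (pi : R) => m e c p m0 e0.
    by field; rewrite m0 e0.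
  apply: cvgMl_tmp; apply: cvgB; first exact: cvgMl_tmp.
  have := R0 (2 * k)%N; apply: cvg_trans; apply: near_eq_cvg.
  by apply: nearW => t; rewrite -[RHS]/((w ^+ (2 * k).+1) t * v t) wXE.
Unshelve. all: by end_near. Qed.

Lemma continuous_wallis (R : realType) (k : nat) :
  continuous (fun t : R => (t / (1 + t ^+ 2)) ^+ (2 * k) / (1 + t ^+ 2)).
Proof.
have cqV : continuous (fun t : R => (1 + t ^+ 2)^-1).
  move=> t; apply: cvgV; first by rewrite gt_eqF// ltr_pwDl// sqr_ge0.
  by apply: cvgD; [exact: cvg_cst|exact: exprn_continuous].
move=> t; apply: cvgM; last exact: cqV.
apply: (@continuous_comp _ _ _ (fun t : R => t / (1 + t ^+ 2))
  (fun x => x ^+ (2 * k))).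
  by apply: cvgM; [exact: cvg_id|exact: cqV].
exact: exprn_continuous.
Qed.

Lemma integral_wallis (R : realType) (k : nat) :
  (\int[@lebesgue_measure R]_(t in `]0%R, +oo[)
     ((t / (1 + t ^+ 2)) ^+ (2 * k) / (1 + t ^+ 2))%:E =
   (pi / 2 * central R k / 4 ^+ k)%:E)%E.
Proof.
have [F [F0 dF Foo]] := wallis_primitive R k.
have q0 (t : R) : 0 < 1 + t ^+ 2 by rewrite ltr_pwDl// sqr_ge0.
pose g (t : R) : R := (t / (1 + t ^+ 2)) ^+ (2 * k) / (1 + t ^+ 2).
have cg : continuous g by exact: continuous_wallis.
have g0 (t : R) : 0 <= t -> 0 <= g t.
  by move=> t0; have /ltW q1 := q0 t; rewrite /g !(divr_ge0, exprn_ge0).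
have dF1 (t : R) : derivable F t 1 by have [] := dF t.
rewrite integral_itv_obnd_cbnd; last exact: continuous_measurable_EFin.
rewrite (@ge0_continuous_FTC2y R g F 0 _ g0 _ Foo) ?F0 ?sube0//.
- exact: continuous_subspaceT.
- rewrite -[X in _ --> X]F0; apply: cvg_at_right_filter.
  exact/differentiable_continuous/derivable1_diffP.
- by move=> t _; rewrite derive1E; have [] := dF t.
Qed.

(** * The value of the elliptic integral *)

Lemma cvg_series_EFin (R : realType) (u : R ^nat) (l : R) :
  series u @ \oo --> l -> (\sum_(0 <= k <oo) (u k)%:E = l%:E)%E.
Proof.
move=> ul; apply/cvg_lim => //.
rewrite (_ : (fun n => _) = EFin \o series u); last first.
  by apply/funext => n; rewrite /= sumEFin.
by apply: cvg_EFin => //; exact: nearW.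
Qed.

(* 1 + t^4 = (1 + t^2)^2 (1 - 2 w^2) with w = t / (1 + t^2). *)
Lemma invsqrt_quartic_series (R : realType) (t : R) :
  ((Num.sqrt (1 + t ^+ 4))^-1%:E =
   \sum_(0 <= k <oo) (central R k * 2 ^+ k *
     ((t / (1 + t ^+ 2)) ^+ (2 * k) / (1 + t ^+ 2)))%:E)%E.
Proof.
have q0 : 0 < 1 + t ^+ 2 by rewrite ltr_pwDl// sqr_ge0.
pose z := 2 * (t / (1 + t ^+ 2)) ^+ 2.
have zE : 1 - z = (1 + t ^+ 4) / (1 + t ^+ 2) ^+ 2.
  by rewrite /z; field; rewrite gt_eqF.
have t4 : 0 < 1 + t ^+ 4 by rewrite ltr_pwDl// exprn_even_ge0.
(* By [zE], 1 - z is positive for every t, so the binomial series converges on the whole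
   half-line. *)
have z01 : 0 <= z < 1.
  rewrite mulr_ge0 ?sqr_ge0//= -subr_gt0 zE.
  by rewrite divr_gt0// exprn_gt0.
apply/esym/cvg_series_EFin.
have := cvg_series_central R z z01.
move=> /(@cvgMl_tmp _ _ _ _ _ (1 + t ^+ 2)^-1).
have -> : (1 + t ^+ 2)^-1 / Num.sqrt (1 - z) = (Num.sqrt (1 + t ^+ 4))^-1.
  rewrite zE sqrtrM ?(ltW t4)// sqrtrV ?exprn_ge0 ?(ltW q0)// sqrtr_sqr gtr0_norm//.
  by field; rewrite !gt_eqF// sqrtr_gt0.
apply: cvg_trans; apply: near_eq_cvg; apply: nearW => n.
rewrite !seriesEord/= mulr_sumr; apply: eq_bigr => -[k /= _] _.
by rewrite /z exprMn -exprM; ring.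
Qed.

(** Nonnegative terms allow integration term by term. The Wallis integral supplies the second factor
    [central] and 4^(-k), which with 2^k leaves 2^(-k). *)
Lemma integral_invsqrt_quartic (R : realType) :
  (\int[@lebesgue_measure R]_(t in `]0%R, +oo[) ((Num.sqrt (1 + t ^+ 4))^-1)%:E =
   \sum_(0 <= k <oo) (pi / 2 * (central R k ^+ 2 / 2 ^+ k))%:E)%E.
Proof.
have q0 (t : R) : 0 < 1 + t ^+ 2 by rewrite ltr_pwDl// sqr_ge0.
under eq_integral do rewrite invsqrt_quartic_series.
have c0 k : 0 <= central R k * 2 ^+ k by rewrite mulr_ge0 ?central_ge0 ?exprn_ge0.
have mg k : measurable_fun (`]0, +oo[ : set R)
    (fun t : R => ((t / (1 + t ^+ 2)) ^+ (2 * k) / (1 + t ^+ 2))%:E).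
  by apply: continuous_measurable_EFin => //; exact: continuous_wallis.
have g0 k (t : R) : `]0, +oo[%classic t ->
    (0 <= ((t / (1 + t ^+ 2)) ^+ (2 * k) / (1 + t ^+ 2))%:E)%E.
  rewrite /= in_itv/= andbT => /ltW t0; have /ltW q1 := q0 t.
  by rewrite lee_fin !(divr_ge0, exprn_ge0).
under eq_integral do under eq_eseriesr do rewrite EFinM.
rewrite integral_nneseries//.
- apply: eq_eseriesr => k _; rewrite ge0_integralZl//; last 3 first.
  + exact: mg.
  + exact: g0.
  + by rewrite lee_fin.
  rewrite integral_wallis -EFinM; congr EFin.
  have -> : (4 : R) = 2 ^+ 2 by rewrite -natrX.
  by rewrite -exprM mulnC exprM; field; rewrite expf_neq0.
- by move=> k; apply: measurable_funeM; exact: mg.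
- by move=> k t t0; apply: mule_ge0; [rewrite lee_fin|exact: g0].
Qed.

(** Let I be the integral of exp(- u^4) and A the sum. Then I^2 = (sqrt(pi) / 4)(pi / 2) A and
    Gamma(1/4) = 4 I, so Gamma(1/4)^2 = 2 pi sqrt(pi) A. Comparison with a geometric series shows
    beforehand that A exists. *)
Lemma cvg_series_central_sqr (R : realType) :
  series (fun k => central R k ^+ 2 / 2 ^+ k) @ \oo -->
  Gamma (4^-1 : R) ^+ 2 / (2 * pi * Num.sqrt pi).
Proof.
have half1 : `|2^-1 : R| < 1 by rewrite ger0_norm; lra.
have cS : cvgn (series (fun k => central R k ^+ 2 / 2 ^+ k)).
  apply: (series_le_cvg (v_ := geometric 1 2^-1)) => [n|n|n|].
  - by rewrite divr_ge0 ?sqr_ge0 ?exprn_ge0.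
  - by rewrite /= mul1r exprn_ge0// invr_ge0.
  - rewrite /= exprVn ler_wpM2r ?invr_ge0 ?exprn_ge0//.
    by rewrite exprn_ile1 ?central_ge0 ?central_le1.
  - exact: is_cvg_geometric_series.
set A := limn (series (fun k => central R k ^+ 2 / 2 ^+ k)).
have pi0 : 0 < pi :> R by exact: pi_gt0.
have spi : 0 < Num.sqrt pi :> R by rewrite sqrtr_gt0.
suff <- : A = Gamma (4^-1 : R) ^+ 2 / (2 * pi * Num.sqrt pi) by exact: cS.
have := integral_expN4_sqr R.
rewrite integral_invsqrt_quartic (@cvg_series_EFin R _ (pi / 2 * A)); last first.
  have /(@cvgMl_tmp _ _ _ _ _ (pi / 2)) :
      series (fun k => central R k ^+ 2 / 2 ^+ k) @ \oo --> A by exact: cS.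
  apply: cvg_trans; apply: near_eq_cvg; apply: nearW => n.
  by rewrite !seriesEord/= mulr_sumr.
rewrite /Gamma /Rintegral integral_Gamma14.
have : (0 <= \int[@lebesgue_measure R]_(u in `]0%R, +oo[) (expR (- u ^+ 4))%:E)%E.
  by apply: integral_ge0 => x _; rewrite lee_fin expR_ge0.
(* I is finite because its square is; hence the real-valued [Rintegral] in [Gamma] is the true value
   and not a default. *)
case: (\int[_]_(_ in _) _)%E => [r _| |//]; last by rewrite mulyy.
rewrite -!EFinM => -[e]; rewrite /= exprMn expr2 [r ^+ 2]expr2 e.
move: spi pi0; move: (pi : R) (A : R) => p a /lt0r_neq0 s0 /lt0r_neq0 p0.
by field; rewrite s0 p0.
Qed.

Theorem mainTheorem1 (R : realType) :
  series (fun k : nat =>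
    ('C(2 * k, k)%:R ^+ 2 / 32 ^+ k) *
      (2 * harmonic_number R (2 * k) - harmonic_number R k))
  @ \oo --> ln 2 * Gamma (4^-1 : R) ^+ 2 / (4 * pi * Num.sqrt pi).
Proof.
have := cvg_series_odd_harmonic _ _ (cvg_series_central_sqr R).
have -> : ln 2 / 2 * (Gamma (4^-1 : R) ^+ 2 / (2 * pi * Num.sqrt pi)) =
    ln 2 * Gamma (4^-1 : R) ^+ 2 / (4 * pi * Num.sqrt pi).
  have pi0 : 0 < pi :> R by exact: pi_gt0.
  have spi : 0 < Num.sqrt pi :> R by rewrite sqrtr_gt0.
  move: spi pi0; move: (pi : R) => p /lt0r_neq0 s0 /lt0r_neq0 p0.
  by field; rewrite s0 p0.
apply: cvg_trans; apply: near_eq_cvg; apply: nearW => n.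
rewrite !seriesEord/=; apply: eq_bigr => -[k /= _] _; congr (_ * _).
rewrite /central expr_div_n -!exprM.
(* One factor 4^k goes to each binomial coefficient, and 2^k stays as the evaluation point 1/2. *)
have -> : (32 : R) = 4 ^+ 2 * 2 by rewrite -natrX -natrM.
by rewrite exprMn invfM mulrA -exprM mulnC.
Qed.
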